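(* Let $n\geq 5$ be an odd integer. Then the function $\mathbb{F}_{3^n}\to\mathbb{F}_{3^n}$, $x\mapsto x^d$, is APN over $\mathbb{F}_{3^n}$ for $$d=\begin{cases} \dfrac{3^{n+1}-1}{8} & \text{if } n\equiv 3 \pmod 4,\\[2mm] \dfrac{3^{n+1}-1}{8}+\dfrac{3^n-1}{2} & \text{if } n\equiv 1 \pmod 4.\end{cases}$$
   Context: Let $q=p^n$ with $p$ a prime number and $n$ a positive integer, and let $\mathbb{F}_q$ be the finite field with $q$ elements. For $f:\mathbb{F}_q\to\mathbb{F}_q$ and $a,b\in\mathbb{F}_q$, let $N_f(a,b)$ denote the number of solutions $x\in\mathbb{F}_q$ of the equation $f(x+a)-f(x)=b$. The function $f$ is called APN (almost perfectly nonlinear) if $\Delta_f:=\max\{N_f(a,b) : a,b\in\mathbb{F}_q,\ a\neq 0\}=2$ (the maximum is exactly $2$). *)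

(* Defs.v *)
(* Mathematical Components. *)
From mathcomp Require Import all_boot all_algebra.

Set Implicit Arguments.
Unset Strict Implicit.
Unset Printing Implicit Defensive.

Import GRing.Theory.

Definition num_sols (F : finFieldType) (f : F -> F) (a b : F) : nat :=
  #|[set x : F | (f (x + a) - f x == b)%R]|.

(* The index set is never empty (take a = 1), so the default value 0 of \max
   plays no role. *)
Definition diff_uniformity (F : finFieldType) (f : F -> F) : nat :=
  \max_(ab : F * F | ab.1 != 0%R) num_sols f ab.1 ab.2.

Definition APN (F : finFieldType) (f : F -> F) : Prop :=
  diff_uniformity f = 2.

(* Only meant for odd n, where the second branch is n = 1 %[mod 4] and both
   truncating divisions are exact. *)
Definition APN_exponent (n : nat) : nat :=
  if n %% 4 == 3 then (3 ^ n.+1 - 1) %/ 8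
  else (3 ^ n.+1 - 1) %/ 8 + (3 ^ n - 1) %/ 2.

(* Main.v *)
(* Write q = 3^n, m = (q - 1)/2 (odd, so -1 is not a square) and f(x) = x^d. Every x
   is of the form +-u^8, and f(+-u^8) = u^2. By homogeneity only the equation
   f(x + 1) - f(x) = b matters; with x = +-u^8 and x + 1 = +-v^8 it reads
   v^2 - u^2 = b together with v^8 +- u^8 = +-1. In characteristic 3 these equations,
   in s = v^2 + u^2 and b, become b s (s^2 + b^2) = +-1 when the signs of x and x + 1
   agree and s^4 + b^4 = +-1 when they differ, and each of the two kinds has at
   most one solution x. Hence no value is taken more than twice.

   If no value were taken twice, x |-> f(x + 1) - f(x) would be a bijection.
   Parametrizing b by b^4 (z^3 + z) = 1, a number of solutions different from 1
   follows from the existence of z <> 0 such that g(z) and g(-z) are both nonzero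
   squares, where g(z) = z^3 + z^2 + 1. If there were no such z, then
     (z^4 - z^16) (1 + g(z)^m) (1 + g(-z)^m) = 0   for all z in F_q,
   but the sum of the left-hand side over F_q is 2: with Z = z^2 we have
   g(z) g(-z) = 1 - Z + Z^2 - Z^3, and the coefficients of the m-th powers
   are read off base 3, since h^m = h(X) h(X^3) ... h(X^(q/3)) on F_q. *)
Require Import Defs.
From mathcomp Require Import all_boot all_algebra all_field.
From mathcomp Require Import ring zify.

Set Implicit Arguments.
Unset Strict Implicit.
Unset Printing Implicit Defensive.

Import GRing.Theory.
Local Open Scope ring_scope.

(** * The differential equation in terms of eighth powers *)

Section EighthPowers.

Variable F : fieldType.
Hypothesis three0 : 3%:R = 0 :> F.
Hypothesis sum_sqr0 : forall a b : F, a ^+ 2 + b ^+ 2 = 0 -> a = 0.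
Hypothesis sqr_or_opp : forall x : F, exists u, x = u ^+ 2 \/ x = - u ^+ 2.

Lemma eq_mod3 (c a b : F) : a - b = 3%:R * c -> a = b.
Proof. by rewrite three0 mul0r => /subr0_eq. Qed.

Lemma sum_sqr0r (a b : F) : a ^+ 2 + b ^+ 2 = 0 -> b = 0.
Proof. by rewrite addrC => /sum_sqr0. Qed.

Lemma sqr_pow4 (k : F) : exists w, k ^+ 2 = w ^+ 4.
Proof. by have [w [->|->]] := sqr_or_opp k; exists w; ring. Qed.

Lemma pow8_or_opp (x : F) : exists u, x = u ^+ 8 \/ x = - u ^+ 8.
Proof.
have [u xE] := sqr_or_opp x; have [v uE] := sqr_pow4 u; have [w wE] := sqr_pow4 v.
have u8 : u ^+ 2 = w ^+ 8.
  by rewrite uE (exprM v 2 2) wE -exprM.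
by exists w; rewrite -u8.
Qed.

Lemma expf_eq0_inv (x : F) k : x ^+ k = 0 -> x = 0.
Proof. by move/eqP; rewrite expf_eq0 => /andP[_ /eqP]. Qed.

Lemma cancel_cube_linear (t b : F) : t * b * (b ^+ 2 + t ^+ 2) = 0 -> b != 0 -> t = 0.
Proof.
move=> /eqP + b0; rewrite !mulf_eq0 (negPf b0) orbF => /orP[/eqP //|/eqP].
by move/sum_sqr0 => bz; rewrite bz eqxx in b0.
Qed.

(** As [4 = 1] and [6 = 0], the expansion of [(V + t)^4] is [V^4 + V^3 t + V t^3 + t^4], and cubing
    is additive. *)
Lemma sub_pow4_translate (U V t : F) :
  (V + t) ^+ 4 - (U + t) ^+ 4 - (V ^+ 4 - U ^+ 4)
  = t * (V - U) * ((V - U) ^+ 2 + t ^+ 2).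
Proof.
apply: (@eq_mod3 (U * V ^+ 2 * t - U * t ^+ 3 - U ^+ 2 * V * t
  - 2%:R * U ^+ 2 * t ^+ 2 - U ^+ 3 * t + V * t ^+ 3 + 2%:R * V ^+ 2 * t ^+ 2
  + V ^+ 3 * t)); ring.
Qed.

Lemma add_pow4 (U V : F) :
  V ^+ 4 + U ^+ 4 = - ((V + U) ^+ 4 + (V - U) ^+ 4).
Proof.
by apply: (@eq_mod3 (4%:R * U ^+ 2 * V ^+ 2 + U ^+ 4 + V ^+ 4)); ring.
Qed.

(** Two pairs of squares with equal differences are translates of each other by some [t]; the
    difference of fourth powers is then preserved only for [t = 0]. *)
Lemma sub_pow4_inj (u v u' v' : F) :
  v ^+ 2 - u ^+ 2 = v' ^+ 2 - u' ^+ 2 ->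
  v ^+ 8 - u ^+ 8 = v' ^+ 8 - u' ^+ 8 -> v ^+ 8 - u ^+ 8 != 0 ->
  u ^+ 2 = u' ^+ 2.
Proof.
move=> db d8 n0; set t := u' ^+ 2 - u ^+ 2.
have Et := sub_pow4_translate (u ^+ 2) (v ^+ 2) t.
have vt : v ^+ 2 + t = v' ^+ 2 by rewrite /t addrCA db; ring.
have ut : u ^+ 2 + t = u' ^+ 2 by rewrite /t; ring.
rewrite vt ut -!exprM d8 subrr in Et.
have t0 : t = 0.
  apply: cancel_cube_linear (esym Et) _; apply: contra n0 => /eqP e.
  by rewrite (_ : _ - _ = (v ^+ 2 - u ^+ 2) * (v ^+ 2 + u ^+ 2) * (v ^+ 4 + u ^+ 4));
    [rewrite e !mul0r | ring].
by rewrite -ut t0 addr0.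
Qed.

(** The pair [(- v^2, - u^2)] has the same difference as [(u^2, v^2)] and the opposite difference of
    fourth powers, so the translation argument applies to it. Here [t = 0] makes two sums of two
    squares vanish. *)
Lemma sub_pow4_opp (u v u' v' : F) :
  v ^+ 2 - u ^+ 2 = v' ^+ 2 - u' ^+ 2 ->
  v ^+ 8 - u ^+ 8 = - (v' ^+ 8 - u' ^+ 8) -> v ^+ 8 - u ^+ 8 = 0.
Proof.
move=> db d8; apply/eqP; apply: contraT => n0; set t := v' ^+ 2 + u ^+ 2.
have Et := sub_pow4_translate (- v ^+ 2) (- u ^+ 2) t.
have vt : - u ^+ 2 + t = v' ^+ 2 by rewrite /t; ring.
have ut : - v ^+ 2 + t = u' ^+ 2.
  have -> : u' ^+ 2 = v' ^+ 2 - (v' ^+ 2 - u' ^+ 2) by ring.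
  rewrite -db /t; ring.
have b0 : - u ^+ 2 - - v ^+ 2 != 0.
  apply: contra n0 => /eqP e.
  by rewrite (_ : _ - _ = (- u ^+ 2 - - v ^+ 2) * (v ^+ 2 + u ^+ 2) * (v ^+ 4 + u ^+ 4));
    [rewrite e !mul0r | ring].
rewrite vt ut in Et.
have t0 : t = 0.
  apply: cancel_cube_linear b0; rewrite -Et.
  have -> : (v' ^+ 2) ^+ 4 - (u' ^+ 2) ^+ 4 = v' ^+ 8 - u' ^+ 8 by ring.
  have -> : (- u ^+ 2) ^+ 4 - (- v ^+ 2) ^+ 4 = - (v ^+ 8 - u ^+ 8) by ring.
  by rewrite d8 opprK subrr.
have u0 := sum_sqr0r t0.
have v0 : v = 0.
  apply: (@sum_sqr0 v u'); rewrite -ut t0; ring.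
by rewrite u0 v0 subrr eqxx in n0.
Qed.

(** By [add_pow4] the hypotheses fix [s^4], so [s' = s], [s' = - s] or [s^2 + s'^2 = 0]; as
    [2 = -1], the sum [s] and the difference determine [u^2] and [v^2]. *)
Lemma add_pow4_inj (u v u' v' : F) :
  v ^+ 2 - u ^+ 2 = v' ^+ 2 - u' ^+ 2 ->
  v ^+ 8 + u ^+ 8 = v' ^+ 8 + u' ^+ 8 -> v ^+ 8 + u ^+ 8 != 0 ->
  u ^+ 2 = u' ^+ 2.
Proof.
move=> db d8 n0.
set s := v ^+ 2 + u ^+ 2; set s' := v' ^+ 2 + u' ^+ 2.
have s4 : s ^+ 4 = s' ^+ 4.
  apply: (@addIr _ ((v ^+ 2 - u ^+ 2) ^+ 4)); apply: oppr_inj.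
  by rewrite -add_pow4 db -add_pow4 -!exprM d8.
have u2 : u ^+ 2 = - (s - (v ^+ 2 - u ^+ 2)) + 3%:R * u ^+ 2 by rewrite /s; ring.
have u2' : u' ^+ 2 = - (s' - (v' ^+ 2 - u' ^+ 2)) + 3%:R * u' ^+ 2 by rewrite /s'; ring.
have v2 : v ^+ 2 = - (s + (v ^+ 2 - u ^+ 2)) + 3%:R * v ^+ 2 by rewrite /s; ring.
have v2' : v' ^+ 2 = - (s' + (v' ^+ 2 - u' ^+ 2)) + 3%:R * v' ^+ 2 by rewrite /s'; ring.
rewrite !three0 !mul0r !addr0 in u2 u2' v2 v2'.
have /eqP : (s - s') * (s + s') * (s ^+ 2 + s' ^+ 2) = 0.
  by rewrite (_ : _ * _ = s ^+ 4 - s' ^+ 4); [rewrite s4 subrr | ring].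
rewrite !mulf_eq0 -orbA => /or3P[/eqP/subr0_eq ss|/eqP ss|/eqP ss].
- by rewrite u2 u2' ss db.
- have e1 : u ^+ 2 + v' ^+ 2 = 0.
    rewrite u2 v2' -db -[RHS]oppr0 -ss; ring.
  have e2 : v ^+ 2 + u' ^+ 2 = 0.
    rewrite v2 u2' -db -[RHS]oppr0 -ss; ring.
  by rewrite (sum_sqr0 e1) (sum_sqr0r e2).
- by rewrite u2 u2' (sum_sqr0 ss) (sum_sqr0r ss) db.
Qed.

(* Put [p = u^4 + v^4], [p' = u'^4 + v'^4], and let [s], [s'] be the sums of the
   two squares. The hypotheses give [(u v)^2 p = s'^4] and [(u' v')^2 p' = s^4],
   while [p p'] is the opposite of a square; as [-1] is not a square, [s s' = 0]. *)
Lemma add_pow4_opp (u v u' v' : F) :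
  v ^+ 2 - u ^+ 2 = v' ^+ 2 - u' ^+ 2 ->
  v ^+ 8 + u ^+ 8 = - (v' ^+ 8 + u' ^+ 8) -> v ^+ 8 + u ^+ 8 = 0.
Proof.
move=> db d8.
set s := v ^+ 2 + u ^+ 2; set s' := v' ^+ 2 + u' ^+ 2.
set b := v ^+ 2 - u ^+ 2 in db.
have q0 : s ^+ 4 + s' ^+ 4 + 2%:R * b ^+ 4 = 0.
  have := add_pow4 (u ^+ 2) (v ^+ 2); have := add_pow4 (u' ^+ 2) (v' ^+ 2).
  rewrite -db -/s -/s' -/b -!exprM d8 => ->; rewrite opprK => /eqP.
  rewrite -subr_eq0 opprK => /eqP <-; ring.
have pE (x y : F) : x * y * (x ^+ 2 + y ^+ 2) = (y - x) ^+ 4 - (x + y) ^+ 4.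
  by apply: (@eq_mod3 (3%:R * x * y ^+ 3 + 3%:R * x ^+ 3 * y)); ring.
have p1 : (u * v) ^+ 2 * (u ^+ 4 + v ^+ 4) = s' ^+ 4.
  have := pE (u ^+ 2) (v ^+ 2); rewrite -/b [u ^+ 2 + _]addrC -/s.
  have -> : u ^+ 2 * v ^+ 2 * ((u ^+ 2) ^+ 2 + (v ^+ 2) ^+ 2)
    = (u * v) ^+ 2 * (u ^+ 4 + v ^+ 4) by ring.
  move=> ->; apply: (@eq_mod3 (b ^+ 4)); rewrite -[RHS]subr0 -q0; ring.
have p2 : (u' * v') ^+ 2 * (u' ^+ 4 + v' ^+ 4) = s ^+ 4.
  have := pE (u' ^+ 2) (v' ^+ 2); rewrite -db [u' ^+ 2 + _]addrC -/s'.
  have -> : u' ^+ 2 * v' ^+ 2 * ((u' ^+ 2) ^+ 2 + (v' ^+ 2) ^+ 2)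
    = (u' * v') ^+ 2 * (u' ^+ 4 + v' ^+ 4) by ring.
  move=> ->; apply: (@eq_mod3 (b ^+ 4)); rewrite -[RHS]subr0 -q0; ring.
(* By [q0], [r^2] equals [2 (s^2 + b^2) (s'^2 + b^2)], where [2 = -1]. *)
set r := s ^+ 2 + b ^+ 2 + s' ^+ 2.
have pp (x y : F) : x ^+ 4 + y ^+ 4 = - ((y ^+ 2 + x ^+ 2) ^+ 2 + (y ^+ 2 - x ^+ 2) ^+ 2).
  by apply: (@eq_mod3 (x ^+ 4 + y ^+ 4)); ring.
have p3 : (u ^+ 4 + v ^+ 4) * (u' ^+ 4 + v' ^+ 4) = - r ^+ 2.
  rewrite !pp -db -/s -/s' -/b /r.
  apply: (@eq_mod3 ((s ^+ 2 + b ^+ 2) * (s' ^+ 2 + b ^+ 2) - b ^+ 4)).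
  rewrite -[RHS]addr0 -q0; ring.
have /sum_sqr0 : (s ^+ 2 * s' ^+ 2) ^+ 2 + (u * v * (u' * v') * r) ^+ 2 = 0.
  have -> : (s ^+ 2 * s' ^+ 2) ^+ 2 = s' ^+ 4 * s ^+ 4 by ring.
  rewrite -p1 -p2 mulrACA p3; ring.
move/eqP; rewrite mulf_eq0 !expf_eq0 /= => /orP[] /eqP s0.
  have u0 : u ^+ 2 = 0 by have /sum_sqr0r -> : v ^+ 2 + u ^+ 2 = 0; rewrite ?expr0n.
  have v0 : v ^+ 2 = 0 by have /sum_sqr0 -> : v ^+ 2 + u ^+ 2 = 0; rewrite ?expr0n.
  by rewrite (expf_eq0_inv u0) (expf_eq0_inv v0) !expr0n addr0.
have -> := d8.
have /sum_sqr0r -> : v' ^+ 2 + u' ^+ 2 = 0 by [].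
have /sum_sqr0 -> : v' ^+ 2 + u' ^+ 2 = 0 by [].
by rewrite !expr0n addr0 oppr0.
Qed.

(** * Uniqueness of solutions with given signs *)

Variable f : F -> F.
Hypothesis f_pow8 : forall u, f (u ^+ 8) = u ^+ 2.
Hypothesis f_opp_pow8 : forall u, f (- u ^+ 8) = u ^+ 2.

(** In both definitions [e] is a sign of [x + 1]. Zero has either sign, so the two kinds overlap at
    [x = 0] and [x = -1]. *)
Definition same_sign (x : F) := exists u v e, (e = 1 \/ e = -1) /\
  [/\ x = e * u ^+ 8, x + 1 = e * v ^+ 8, f x = u ^+ 2 & f (x + 1) = v ^+ 2].

Definition opposite_sign (x : F) := exists u v e, (e = 1 \/ e = -1) /\
  [/\ x = - (e * u ^+ 8), x + 1 = e * v ^+ 8, f x = u ^+ 2 & f (x + 1) = v ^+ 2].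

Lemma same_or_opposite x : same_sign x \/ opposite_sign x.
Proof.
have [u [xE|xE]] := pow8_or_opp x; have [v [yE|yE]] := pow8_or_opp (x + 1).
- left; exists u, v, 1; split; [by left|].
  by rewrite !mul1r; split=> //; rewrite ?yE ?xE.
- right; exists u, v, (-1); split; [by right|].
  by rewrite !mulN1r opprK; split=> //; rewrite ?yE ?xE.
- right; exists u, v, 1; split; [by left|].
  by rewrite !mul1r; split=> //; rewrite ?yE ?xE.
- left; exists u, v, (-1); split; [by right|].
  by rewrite !mulN1r; split=> //; rewrite ?yE ?xE.
Qed.

Lemma sign_or (e e' : F) : e = 1 \/ e = -1 -> e' = 1 \/ e' = -1 ->
  [/\ e * e = 1, e != 0 & e' = e \/ e' = - e].
Proof.
by case=> -> [] ->; rewrite ?opprK ?mulrNN ?mulr1 ?oppr_eq0 oner_eq0; split; auto.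
Qed.

Lemma same_sign_inj x x' : same_sign x -> same_sign x' ->
  f (x + 1) - f x = f (x' + 1) - f x' -> x = x'.
Proof.
move=> [u [v [e [he [xE yE fx fy]]]]] [u' [v' [e' [he' [xE' yE' fx' fy']]]]].
rewrite fx fy fx' fy' => db.
have [ee e0 e'E] := sign_or he he'.
have dE : e * (v ^+ 8 - u ^+ 8) = 1 by rewrite mulrBr -yE -xE addrAC subrr add0r.
have dE' : e' * (v' ^+ 8 - u' ^+ 8) = 1 by rewrite mulrBr -yE' -xE' addrAC subrr add0r.
have n0 : v ^+ 8 - u ^+ 8 != 0.
  by apply/eqP => h; move/eqP: dE; rewrite h mulr0 eq_sym oner_eq0.
have {}dE : v ^+ 8 - u ^+ 8 = e by rewrite -[RHS]mulr1 -dE mulrA ee mul1r.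
case: e'E => e'E; rewrite e'E in dE' xE'.
  have {}dE' : v' ^+ 8 - u' ^+ 8 = e by rewrite -[RHS]mulr1 -dE' mulrA ee mul1r.
  have uu : u ^+ 2 = u' ^+ 2 by apply: sub_pow4_inj db _ n0; rewrite dE dE'.
  by rewrite xE xE' (exprM u 2 4) uu -exprM.
have {}dE' : v' ^+ 8 - u' ^+ 8 = - e by rewrite -[RHS]mulr1 -dE' mulrA mulrNN ee mul1r.
case/eqP: n0; apply: (sub_pow4_opp db); by rewrite dE dE' opprK.
Qed.

Lemma opposite_sign_inj x x' : opposite_sign x -> opposite_sign x' ->
  f (x + 1) - f x = f (x' + 1) - f x' -> x = x'.
Proof.
move=> [u [v [e [he [xE yE fx fy]]]]] [u' [v' [e' [he' [xE' yE' fx' fy']]]]].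
rewrite fx fy fx' fy' => db.
have [ee e0 e'E] := sign_or he he'.
have dE : e * (v ^+ 8 + u ^+ 8) = 1
  by rewrite mulrDr -yE -[e * u ^+ 8]opprK -xE addrAC subrr add0r.
have dE' : e' * (v' ^+ 8 + u' ^+ 8) = 1
  by rewrite mulrDr -yE' -[e' * u' ^+ 8]opprK -xE' addrAC subrr add0r.
have n0 : v ^+ 8 + u ^+ 8 != 0.
  by apply/eqP => h; move/eqP: dE; rewrite h mulr0 eq_sym oner_eq0.
have {}dE : v ^+ 8 + u ^+ 8 = e by rewrite -[RHS]mulr1 -dE mulrA ee mul1r.
case: e'E => e'E; rewrite e'E in dE' xE'.
  have {}dE' : v' ^+ 8 + u' ^+ 8 = e by rewrite -[RHS]mulr1 -dE' mulrA ee mul1r.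
  have uu : u ^+ 2 = u' ^+ 2 by apply: add_pow4_inj db _ n0; rewrite dE dE'.
  by rewrite xE xE' (exprM u 2 4) uu -exprM.
have {}dE' : v' ^+ 8 + u' ^+ 8 = - e by rewrite -[RHS]mulr1 -dE' mulrA mulrNN ee mul1r.
case/eqP: n0; apply: (add_pow4_opp db); by rewrite dE dE' opprK.
Qed.


(** * Solutions with a prescribed difference *)

Lemma mul_eq_sqr (P Q k : F) : P * Q = k ^+ 2 -> k != 0 ->
  exists u v, [/\ u != 0, v != 0 &
    (P = u ^+ 2 /\ Q = v ^+ 2) \/ (P = - u ^+ 2 /\ Q = - v ^+ 2)].
Proof.
move=> PQ k0; have [u Pu] := sqr_or_opp P; have [v Qv] := sqr_or_opp Q.
have : P * Q != 0 by rewrite PQ expf_neq0.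
rewrite mulf_eq0 negb_or => /andP[P0 Q0].
have u0 : u != 0.
  by apply: contra P0 => /eqP u0; case: Pu => ->; rewrite u0 expr0n ?oppr0.
have v0 : v != 0.
  by apply: contra Q0 => /eqP v0; case: Qv => ->; rewrite v0 expr0n ?oppr0.
exists u, v; split=> //.
have mixed : P * Q = - (u * v) ^+ 2 -> False.
  rewrite PQ => h; case/eqP: k0; apply: (@sum_sqr0 k (u * v)); by rewrite h addNr.
case: Pu => Pu; case: Qv => Qv; [by left| | |by right];
  by case: mixed; rewrite Pu Qv; ring.
Qed.

(** The pair [(f x, f (x + 1))] is [(U, V)] when both are squares and [(- V, - U)] when both are
    minus squares; the difference is [V - U] either way. *)
Lemma same_sign_solution (U V k : F) : U * V = k ^+ 2 -> k != 0 ->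
  V ^+ 4 - U ^+ 4 = -1 ->
  exists x l, [/\ f (x + 1) - f x = V - U, l != 0 & x * (x + 1) = l ^+ 2].
Proof.
move=> UV k0 d4; have [u [v [u0 v0 [[Uu Vv]|[Uu Vv]]]]] := mul_eq_sqr UV k0.
- exists (- u ^+ 8), (u ^+ 4 * v ^+ 4).
  have -> : - u ^+ 8 + 1 = - v ^+ 8 by rewrite -[1]opprK -d4 Uu Vv; ring.
  by rewrite !f_opp_pow8 Uu Vv mulf_neq0 ?expf_neq0 //; split=> //; ring.
- exists (v ^+ 8), (u ^+ 4 * v ^+ 4).
  have -> : v ^+ 8 + 1 = u ^+ 8 by rewrite -[1]opprK -d4 Uu Vv; ring.
  rewrite !f_pow8 Uu Vv mulf_neq0 ?expf_neq0 //; split=> //; ring.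
Qed.

Lemma opposite_sign_solution (U V k e : F) : U * V = k ^+ 2 -> k != 0 ->
  e = 1 \/ e = -1 -> V ^+ 4 + U ^+ 4 = e ->
  exists x l, [/\ f (x + 1) - f x = V - U, l != 0 & x * (x + 1) = - l ^+ 2].
Proof.
move=> UV k0 he d4; have [u [v [u0 v0 [[Uu Vv]|[Uu Vv]]]]] := mul_eq_sqr UV k0;
  case: he => eE; rewrite {}eE Uu Vv in d4.
- exists (- u ^+ 8), (u ^+ 4 * v ^+ 4).
  have -> : - u ^+ 8 + 1 = v ^+ 8 by rewrite -d4; ring.
  by rewrite f_pow8 !f_opp_pow8 Uu Vv mulf_neq0 ?expf_neq0 //; split=> //; ring.
- exists (u ^+ 8), (u ^+ 4 * v ^+ 4).
  have -> : u ^+ 8 + 1 = - v ^+ 8 by rewrite -[1]opprK -d4; ring.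
  by rewrite f_pow8 !f_opp_pow8 Uu Vv mulf_neq0 ?expf_neq0 //; split=> //; ring.
- exists (- v ^+ 8), (u ^+ 4 * v ^+ 4).
  have -> : - v ^+ 8 + 1 = u ^+ 8 by rewrite -d4; ring.
  by rewrite f_pow8 !f_opp_pow8 Uu Vv mulf_neq0 ?expf_neq0 //; split=> //; ring.
- exists (v ^+ 8), (u ^+ 4 * v ^+ 4).
  have -> : v ^+ 8 + 1 = - u ^+ 8 by rewrite -[1]opprK -d4; ring.
  by rewrite f_pow8 !f_opp_pow8 Uu Vv mulf_neq0 ?expf_neq0 //; split=> //; ring.
Qed.

(* The two solutions are told apart by whether [x * (x + 1)] is a square. *)
Lemma collision (b z t r : F) (e : F) :
  b ^+ 4 * (z ^+ 3 + z) = 1 -> z ^+ 2 - 1 = r ^+ 2 -> r != 0 ->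
  e = 1 \/ e = -1 -> t ^+ 4 + 1 = - (e * (z ^+ 3 + z)) ->
  (exists2 k, k != 0 & t ^+ 2 - 1 = k ^+ 2) ->
  exists x x', x != x' /\ f (x + 1) - f x = f (x' + 1) - f x'.
Proof.
move=> by1 zr r0 he te [k k0 tk].
have b0 : b != 0.
  by apply/eqP => b0; move/eqP: by1; rewrite b0 expr0n mul0r eq_sym oner_eq0.
(* The pair [b (1 - w)], [- b (1 + w)] has difference [b] and sum [b w]. Taking [w = z] gives a
   same-sign solution, [w = t] an opposite-sign one. *)
have UV w : (b * (1 - w)) * (- (b * (1 + w))) = b ^+ 2 * (w ^+ 2 - 1) by ring.
have Vb w : - (b * (1 + w)) - b * (1 - w) = b.
  by apply: (@eq_mod3 (- b)); ring.
have [] := @same_sign_solution (b * (1 - z)) (- (b * (1 + z))) (b * r).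
- by rewrite UV zr; ring.
- by rewrite mulf_neq0.
- have -> : -1 = - (b ^+ 4 * (z ^+ 3 + z)) by rewrite by1.
  by apply: (@eq_mod3 (3%:R * b ^+ 4 * (z ^+ 3 + z))); ring.
move=> x [l [fx l0 xl]].
have [] := @opposite_sign_solution (b * (1 - t)) (- (b * (1 + t))) (b * k) e.
- by rewrite UV tk; ring.
- by rewrite mulf_neq0.
- by [].
- have -> : e = - (b ^+ 4 * (t ^+ 4 + 1)) by rewrite te -[LHS]mulr1 -[in LHS]by1; ring.
  by apply: (@eq_mod3 (b ^+ 4 * (1 + 4%:R * t ^+ 2 + t ^+ 4))); ring.
move=> x' [l' [fx' l'0 xl']].
exists x, x'; rewrite fx fx' !Vb; split=> //.
apply/eqP => xx; case/eqP: l0; apply: (@sum_sqr0 l l').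
by rewrite -xl xx xl' addNr.
Qed.

(** * From a suitable z to a repeated or a missed value *)

Lemma sqr_add1_neq0 (x : F) : x ^+ 2 + 1 != 0.
Proof.
apply/eqP => h; have h1 := @sum_sqr0r x 1; rewrite expr1n in h1.
by move/h1/eqP: h; rewrite oner_eq0.
Qed.

(** This is the cofactor of [z - 1] in [z^3 + z^2 + 1], whose only root is therefore [1]. *)
Lemma factor_neq0 (z : F) : z ^+ 2 - z - 1 != 0.
Proof.
have -> : z ^+ 2 - z - 1 = (z + 1) ^+ 2 + 1 by apply: (@eq_mod3 (- 1 - z)); ring.
exact: sqr_add1_neq0.
Qed.

Lemma sqr_sub1_neq0 (z a c : F) :
  z ^+ 3 + z ^+ 2 + 1 = a ^+ 2 -> - z ^+ 3 + z ^+ 2 + 1 = c ^+ 2 ->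
  a != 0 -> c != 0 -> z ^+ 2 - 1 != 0.
Proof.
move=> ga gc a0 c0; apply/eqP => z1.
have : (z - 1) * (z + 1) = 0 by rewrite -z1; ring.
move/eqP; rewrite mulf_eq0 => /orP[/eqP/subr0_eq zE|/eqP/addr0_eq zE].
  case/eqP: a0; apply: (@expf_eq0_inv _ 2); rewrite -ga zE.
  by rewrite -three0; ring.
case/eqP: c0; apply: (@expf_eq0_inv _ 2); rewrite -gc (_ : z = -1); last by rewrite -zE opprK.
by rewrite -three0; ring.
Qed.

(** By [collision] it suffices to solve [t^4 + 1 = - e y] with [t^2 - 1] a nonzero square. The
    candidates are [w] for [e = -1] and [t] for [e = 1]; if both failed, [t^4 w^4] would be minus a
    square. *)
Lemma collision_of_sqr (z a c r b : F) :
  b ^+ 4 * (z ^+ 3 + z) = 1 ->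
  z ^+ 3 + z ^+ 2 + 1 = a ^+ 2 -> - z ^+ 3 + z ^+ 2 + 1 = c ^+ 2 ->
  a != 0 -> c != 0 -> r != 0 -> z ^+ 2 - 1 = r ^+ 2 ->
  exists x x', x != x' /\ f (x + 1) - f x = f (x' + 1) - f x'.
Proof.
move=> by1 ga gc a0 c0 r0 zr; set y := z ^+ 3 + z in by1.
(* From [(y - 1) g(z) = (z^2 - 1) (z^2 - z - 1)^2] and its analogue for [- z], both [y - 1] and
   [- (y + 1)] are squares, hence fourth powers. *)
have [w wE] := sqr_pow4 (r * (z ^+ 2 - z - 1) / a).
have [t tE] := sqr_pow4 (r * ((- z) ^+ 2 - (- z) - 1) / c).
have w0 : w != 0.
  apply/eqP => w0; move/eqP: wE; rewrite w0 expr0n expf_eq0 /= !mulf_eq0.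
  by rewrite (negPf r0) (negPf (factor_neq0 z)) invr_eq0 (negPf a0).
have t0 : t != 0.
  apply/eqP => t0; move/eqP: tE; rewrite t0 expr0n expf_eq0 /= !mulf_eq0.
  by rewrite (negPf r0) (negPf (factor_neq0 (- z))) invr_eq0 (negPf c0).
have {wE} w4 : w ^+ 4 = y - 1.
  rewrite -wE expr_div_n -ga exprMn -zr.
  have g0 : z ^+ 3 + z ^+ 2 + 1 != 0 by rewrite ga expf_neq0.
  apply: (canLR (mulfK g0)); apply/esym.
  by apply: (@eq_mod3 (z - z ^+ 2 - z ^+ 3 + z ^+ 4 + z ^+ 5)); rewrite /y; ring.
have {tE} t4 : t ^+ 4 = - (y + 1).
  rewrite -tE expr_div_n -gc exprMn -zr.
  have g0 : - z ^+ 3 + z ^+ 2 + 1 != 0 by rewrite gc expf_neq0.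
  apply: (canLR (mulfK g0)); apply/esym.
  by apply: (@eq_mod3 (- (z + z ^+ 2 - z ^+ 3 - z ^+ 4 + z ^+ 5))); rewrite /y; ring.
have [p wp] := sqr_or_opp (w ^+ 2 - 1); have [q tq] := sqr_or_opp (t ^+ 2 - 1).
have wt : (w ^+ 2 - 1) * (w ^+ 2 + 1) = - t ^+ 4.
  rewrite (_ : _ * _ = w ^+ 4 - 1); last by ring.
  by rewrite w4 t4; apply: (@eq_mod3 (- 1)); ring.
have tw : (t ^+ 2 - 1) * (t ^+ 2 + 1) = - w ^+ 4.
  rewrite (_ : _ * _ = t ^+ 4 - 1); last by ring.
  by rewrite w4 t4; apply: (@eq_mod3 (- 1)); ring.
have p0 : p != 0.
  apply/eqP => p0; move/eqP: wt; rewrite (_ : w ^+ 2 - 1 = 0).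
    by rewrite mul0r eq_sym oppr_eq0 expf_eq0 (negPf t0).
  by case: wp => ->; rewrite p0 expr0n ?oppr0.
have q0 : q != 0.
  apply/eqP => q0; move/eqP: tw; rewrite (_ : t ^+ 2 - 1 = 0).
    by rewrite mul0r eq_sym oppr_eq0 expf_eq0 (negPf w0).
  by case: tq => ->; rewrite q0 expr0n ?oppr0.
case: wp => wp.
  apply: (@collision b z w r (-1)) => //; [by right| |by exists p].
  by rewrite w4 -/y; ring.
case: tq => tq.
  apply: (@collision b z t r 1) => //; [by left| |by exists q].
  by rewrite t4 -/y; ring.
(* As [w^4 + t^4 = 1], the square on the right reduces to [2 (w^2 + 1) (t^2 + 1)], where
   [2 = -1]. *)
have rho : (w ^+ 2 + 1) * (t ^+ 2 + 1) = - (1 + w ^+ 2 + t ^+ 2) ^+ 2.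
  have e : (1 + w ^+ 2 + t ^+ 2) ^+ 2
    = 2%:R * ((w ^+ 2 + 1) * (t ^+ 2 + 1)) + (w ^+ 4 + t ^+ 4 - 1) by ring.
  by rewrite e w4 t4; apply: (@eq_mod3 ((w ^+ 2 + 1) * (t ^+ 2 + 1) - 1)); ring.
case/eqP: (mulf_neq0 (expf_neq0 2 t0) (expf_neq0 2 w0)).
apply: (@sum_sqr0 _ (p * q * (1 + w ^+ 2 + t ^+ 2))).
have -> : (t ^+ 2 * w ^+ 2) ^+ 2 = (- t ^+ 4) * (- w ^+ 4) by ring.
rewrite -wt -tw mulrACA rho wp tq; ring.
Qed.

(** Now [y - 1] and [- (y + 1)] are minus nonzero squares. An opposite-sign solution would make one
    of them a fourth power; a same-sign one has [s / b = - e z], so [u^2 v^2 = b^2 (z^2 - 1)] would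
    be minus a nonzero square. *)
Lemma value_missed (z a c r b : F) :
  b ^+ 4 * (z ^+ 3 + z) = 1 ->
  z ^+ 3 + z ^+ 2 + 1 = a ^+ 2 -> - z ^+ 3 + z ^+ 2 + 1 = c ^+ 2 ->
  a != 0 -> c != 0 -> r != 0 -> z ^+ 2 - 1 = - r ^+ 2 ->
  forall x, f (x + 1) - f x != b.
Proof.
move=> by1 ga gc a0 c0 r0 zr x; set y := z ^+ 3 + z in by1.
have b0 : b != 0.
  by apply/eqP => b0; move/eqP: by1; rewrite b0 expr0n mul0r eq_sym oner_eq0.
have yP : exists2 h, h != 0 & y - 1 = - h ^+ 2.
  exists (r * (z ^+ 2 - z - 1) / a).
    by rewrite !mulf_neq0 ?invr_eq0 ?factor_neq0.
  rewrite expr_div_n exprMn -2!mulNr; apply: (canRL (mulfK (expf_neq0 2 a0))).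
  rewrite -ga -zr.
  by apply: (@eq_mod3 (z - z ^+ 2 - z ^+ 3 + z ^+ 4 + z ^+ 5)); rewrite /y; ring.
have yN : exists2 h, h != 0 & y + 1 = h ^+ 2.
  exists (r * ((- z) ^+ 2 - (- z) - 1) / c).
    by rewrite !mulf_neq0 ?invr_eq0 ?factor_neq0.
  rewrite expr_div_n exprMn; apply: (canRL (mulfK (expf_neq0 2 c0))).
  rewrite -gc -[r ^+ 2]opprK -zr.
  by apply: (@eq_mod3 (z + z ^+ 2 - z ^+ 3 - z ^+ 4 + z ^+ 5)); rewrite /y; ring.
apply/eqP => fb; have [] := same_or_opposite x; move=> [u [v [e [he [xE yE fx fy]]]]];
  have [ee e0 _] := sign_or he he; rewrite fx fy in fb;
  set s := v ^+ 2 + u ^+ 2.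
  have dE : e * (v ^+ 8 - u ^+ 8) = 1 by rewrite mulrBr -yE -xE addrAC subrr add0r.
  have sb : - (b * s * (s ^+ 2 + b ^+ 2)) = e.
    rewrite -[RHS]mulr1 -dE mulrA ee mul1r -fb /s.
    by apply: (@eq_mod3 (u ^+ 8 - v ^+ 8)); ring.
  set X := s / b; have sX : s = X * b by rewrite /X divfK.
  have XE : X ^+ 3 + X = - (e * y).
    apply: (mulfI (expf_neq0 4 b0)); rewrite mulrN mulrCA by1 mulr1 -[e in RHS]sb.
    by rewrite sX; ring.
  (* The map [X |-> X^3 + X] is additive with trivial kernel and sends both [X] and [- e z] to
     [- e y]. *)
  have D : X + e * z = 0.
    apply: (@cancel_cube_linear _ 1); last exact: oner_neq0.
    have e3 : e ^+ 3 = e by rewrite -[RHS]mul1r -ee; ring.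
    have -> : 0 = (X ^+ 3 + X) + e ^+ 3 * z ^+ 3 + e * z by rewrite XE e3 /y; ring.
    by apply: (@eq_mod3 (X ^+ 2 * e * z + X * e ^+ 2 * z ^+ 2)); ring.
  have s2 : s ^+ 2 = b ^+ 2 * z ^+ 2.
    by rewrite sX -[X]opprK (addr0_eq D) -[z ^+ 2]mul1r -ee; ring.
  have : u ^+ 2 * v ^+ 2 = - (b ^+ 2 * r ^+ 2).
    transitivity (s ^+ 2 - b ^+ 2).
      by rewrite -fb /s; apply: (@eq_mod3 (- (u ^+ 2 * v ^+ 2))); ring.
    by rewrite -[r ^+ 2]opprK -zr s2; ring.
  rewrite -!exprMn => /eqP; rewrite -addr_eq0 => /eqP/sum_sqr0r/eqP.
  by rewrite mulf_eq0 (negPf b0) (negPf r0).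
have dE : e * (v ^+ 8 + u ^+ 8) = 1
  by rewrite mulrDr -yE -[e * u ^+ 8]opprK -xE addrAC subrr add0r.
have sb : s ^+ 4 + b ^+ 4 = - e.
  apply: oppr_inj; rewrite opprK -[RHS]mulr1 -dE mulrA ee mul1r -fb /s -add_pow4.
  by rewrite -!exprM.
set X := s / b; have sX : s = X * b by rewrite /X divfK.
have XE : X ^+ 4 + 1 = - (e * y).
  apply: (mulfI (expf_neq0 4 b0)); rewrite mulrN mulrCA by1 mulr1 -sb sX; ring.
case: he => he; rewrite he in XE.
  have [h h0 yh] := yN; case/eqP: h0; apply: (@sum_sqr0r (X ^+ 2)).
  by rewrite -yh -exprM -[_ + 1]opprK; apply/eqP; rewrite subr_eq0; apply/eqP;
    apply: (@addIr _ 1); rewrite XE; ring.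
have [h h0 yh] := yP; case/eqP: h0; apply: (@sum_sqr0r (X ^+ 2)).
rewrite -[h ^+ 2]opprK -yh -exprM; apply/eqP; rewrite subr_eq0; apply/eqP.
by apply: (@addIr _ 1); rewrite XE; ring.
Qed.

Lemma not_planar_pos (z a c k : F) :
  z ^+ 3 + z = k ^+ 2 -> z != 0 ->
  z ^+ 3 + z ^+ 2 + 1 = a ^+ 2 -> - z ^+ 3 + z ^+ 2 + 1 = c ^+ 2 ->
  a != 0 -> c != 0 ->
  (exists x x', x != x' /\ f (x + 1) - f x = f (x' + 1) - f x') \/
  (exists b, forall x, f (x + 1) - f x != b).
Proof.
move=> yk z0 ga gc a0 c0.
have k0 : k != 0.
  apply/eqP => k0; move/eqP: yk; rewrite k0 expr0n.
  rewrite (_ : _ + _ = z * (z ^+ 2 + 1)); last by ring.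
  by rewrite mulf_eq0 (negPf z0) (negPf (sqr_add1_neq0 z)).
have [b bE] := sqr_pow4 k^-1.
have by1 : b ^+ 4 * (z ^+ 3 + z) = 1 by rewrite -bE yk -exprMn mulVf // expr1n.
have z1 := sqr_sub1_neq0 ga gc a0 c0.
have [r zr] := sqr_or_opp (z ^+ 2 - 1).
have r0 : r != 0.
  by apply: contra z1 => /eqP r0; case: zr => ->; rewrite r0 expr0n ?oppr0.
case: zr => zr; [left | right].
  exact: collision_of_sqr by1 ga gc a0 c0 r0 zr.
exists b; exact: value_missed by1 ga gc a0 c0 r0 zr.
Qed.

(** Replacing [z] by [- z] negates [z^3 + z] and exchanges the two cubics, so [z^3 + z] may be
    assumed to be a square. *)
Lemma not_planar (z a c : F) : z != 0 ->
  z ^+ 3 + z ^+ 2 + 1 = a ^+ 2 -> - z ^+ 3 + z ^+ 2 + 1 = c ^+ 2 ->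
  a != 0 -> c != 0 ->
  (exists x x', x != x' /\ f (x + 1) - f x = f (x' + 1) - f x') \/
  (exists b, forall x, f (x + 1) - f x != b).
Proof.
move=> z0 ga gc a0 c0; have [k [yk|yk]] := sqr_or_opp (z ^+ 3 + z).
  exact: not_planar_pos yk z0 ga gc a0 c0.
apply: (@not_planar_pos (- z) c a k); rewrite ?oppr_eq0 //.
- by rewrite -[k ^+ 2]opprK -yk; ring.
- by rewrite -gc; ring.
- by rewrite -ga; ring.
Qed.

End EighthPowers.

(** * Coefficients of quadratic-character polynomials *)

(** The number with [n] digits [1] in base 3. *)
Definition repunit3 (n : nat) : nat := ((3 ^ n).-1)./2.

Lemma repunit3E n : (3 ^ n = 2 * repunit3 n + 1)%N.
Proof.
have n0 : (0 < 3 ^ n)%N by rewrite expn_gt0.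
have o : odd (3 ^ n) by rewrite oddX orbT.
by rewrite /repunit3; lia.
Qed.

Lemma repunit3S n : repunit3 n.+1 = (3 * repunit3 n + 1)%N.
Proof. have := repunit3E n.+1; rewrite expnS repunit3E; lia. Qed.

Lemma odd_repunit3 n : odd (repunit3 n) = odd n.
Proof. by elim: n => // n IH; rewrite repunit3S addn1 oddS oddM /= IH. Qed.

Section FrobeniusProduct.

Variable R : comNzRingType.

(* [h * h('X^3) * ... * h('X^(3^(n-1)))]: when cubing commutes with [h], it has the
   same values as [h ^+ repunit3 n], that is, the quadratic character of [h]. *)
Fixpoint frobenius_prod (h : {poly R}) (n : nat) : {poly R} :=
  if n is n'.+1 then h * (frobenius_prod h n' \Po 'X^3) else 1.

Lemma horner_frobenius_prod (h : {poly R}) (n : nat) (x : R) :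
  (forall y, h.[y ^+ 3] = h.[y] ^+ 3) ->
  (frobenius_prod h n).[x] = h.[x] ^+ repunit3 n.
Proof.
move=> hF; elim: n x => [|n IH] x; first by rewrite hornerC.
by rewrite hornerM horner_comp hornerXn IH hF repunit3S addn1 -exprM -exprS.
Qed.

Lemma size_frobenius_prod (h : {poly R}) (n : nat) :
  (size h <= 4)%N -> (size (frobenius_prod h n) <= (3 * repunit3 n).+1)%N.
Proof.
move=> hs; elim: n => [|n IH]; first by rewrite size_poly1.
rewrite /=; apply: leq_trans (size_polyMleq _ _) _.
have := size_comp_poly_leq (frobenius_prod h n) 'X^3.
rewrite size_polyXn repunit3S /=.
move: IH hs; set p := size (frobenius_prod h n); set q := size (_ \Po _).
set s := size h; lia.
Qed.

Definition cubic (a b c d : R) : {poly R} :=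
  a%:P + b *: 'X + c *: 'X^2 + d *: 'X^3.

Variables a b c d : R.

Lemma horner_cubic x : (cubic a b c d).[x] = a + b * x + c * x ^+ 2 + d * x ^+ 3.
Proof. by rewrite !hornerE. Qed.

Lemma size_cubic : (size (cubic a b c d) <= 4)%N.
Proof.
apply/leq_sizeP => k k4; rewrite !(coefD, coefZ, coefC, coefX, coefXn).
by case: k k4 => [|[|[|[|k]]]] //= _; rewrite !mulr0 !addr0.
Qed.

Let P := frobenius_prod (cubic a b c d).

(** Here [q j] is the coefficient of [X^j] in the previous product taken at [X^3]. The next three
    lemmas separate the last base 3 digit of the index. *)
Lemma coef_frobenius_prodS n k : (P n.+1)`_k =
  let q j := if (3 %| j)%N then (P n)`_(j %/ 3) else 0 in
  a * q k + b * (if k is j.+1 then q j else 0)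
  + c * (if k is j.+2 then q j else 0) + d * (if k is j.+3 then q j else 0).
Proof.
rewrite /P /= {1}/cubic -/P !mulrDl mul_polyC !coefD -!scalerAl !coefZ !coefXnM coefXM.
by rewrite !coef_comp_poly_Xn //; case: k => [|[|[|k]]] //=; rewrite ?subSS ?subn0.
Qed.

Lemma coef_frobenius_prod_mod0 n k :
  (P n.+1)`_(3 * k.+1) = a * (P n)`_k.+1 + d * (P n)`_k.
Proof.
have -> : (3 * k.+1)%N = (3 * k).+3 by lia.
rewrite coef_frobenius_prodS /=.
have -> : (3 %| (3 * k).+3)%N by lia.
have -> : (3 %| (3 * k).+2)%N = false by lia.
have -> : (3 %| (3 * k).+1)%N = false by lia.
have -> : (3 %| 3 * k)%N by lia.
have -> : ((3 * k).+3 %/ 3 = k.+1)%N by lia.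
have -> : (3 * k %/ 3 = k)%N by lia.
by rewrite !mulr0 !addr0.
Qed.

Lemma coef_frobenius_prod_mod1 n k : (P n.+1)`_(3 * k + 1) = b * (P n)`_k.
Proof.
rewrite addn1 coef_frobenius_prodS /=.
have -> : (3 %| (3 * k).+1)%N = false by lia.
have -> : (3 %| 3 * k)%N by lia.
have -> : (3 * k %/ 3 = k)%N by lia.
case: k => [|k]; first by rewrite !mulr0 add0r !addr0.
have -> : (3 * k.+1)%N = (3 * k).+3 by lia.
have -> : (3 %| (3 * k).+2)%N = false by lia.
have -> : (3 %| (3 * k).+1)%N = false by lia.
by rewrite !mulr0 add0r !addr0.
Qed.

Lemma coef_frobenius_prod_mod2 n k : (P n.+1)`_(3 * k + 2) = c * (P n)`_k.
Proof.
rewrite addn2 coef_frobenius_prodS /=.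
have -> : (3 %| (3 * k).+2)%N = false by lia.
have -> : (3 %| (3 * k).+1)%N = false by lia.
have -> : (3 %| 3 * k)%N by lia.
have -> : (3 * k %/ 3 = k)%N by lia.
case: k => [|k]; first by rewrite !mulr0 !add0r !addr0.
have -> : (3 * k.+1)%N = (3 * k).+3 by lia.
have -> : (3 %| (3 * k).+2)%N = false by lia.
by rewrite !mulr0 !add0r !addr0.
Qed.

End FrobeniusProduct.

(** * Coefficients for the cubic 1 - X + X^2 - X^3 *)

Section AlternatingCubic.

Variable R : comNzRingType.

Let C n k := (frobenius_prod (cubic 1 (-1) 1 (-1) : {poly R}) n)`_k.

Let C0 n k : C n.+1 (3 * k.+1) = C n k.+1 - C n k.
Proof. by rewrite /C coef_frobenius_prod_mod0 mul1r mulN1r. Qed.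

Let C1 n k : C n.+1 (3 * k + 1) = - C n k.
Proof. by rewrite /C coef_frobenius_prod_mod1 mulN1r. Qed.

Let C2 n k : C n.+1 (3 * k + 2) = C n k.
Proof. by rewrite /C coef_frobenius_prod_mod2 mul1r. Qed.

Let C_top n k : (3 * repunit3 n < k)%N -> C n k = 0.
Proof.
move=> nk; apply: nth_default.
by apply: leq_trans nk; apply/size_frobenius_prod/size_cubic.
Qed.

Let C_rep n : C n (repunit3 n) = (-1) ^+ n.
Proof.
elim: n => [|n IH]; first by rewrite /C /= coefC.
by rewrite repunit3S C1 IH exprS mulN1r.
Qed.

Let C_2rep n : C n (2 * repunit3 n) = 1.
Proof.
elim: n => [|n IH]; first by rewrite /C /= coefC.
have -> : (2 * repunit3 n.+1 = 3 * (2 * repunit3 n) + 2)%N by rewrite repunit3S; lia.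
by rewrite C2 IH.
Qed.

Let C_2rep1 n : C n.+1 (2 * repunit3 n.+1 - 1) = -1.
Proof.
have -> : (2 * repunit3 n.+1 - 1 = 3 * (2 * repunit3 n) + 1)%N by rewrite repunit3S; lia.
by rewrite C1 C_2rep.
Qed.

(** Stripping two base 3 digits, with [m = 9 r + 4], expresses the six coefficients by those at [r],
    [r - 1], [2 r], [2 r - 1] and [3 r]. The unknown values at [r - 1] and [3 r] cancel. *)
Lemma coef_difference n : odd n -> (0 < n)%N ->
  let m := repunit3 n.+2 in
  - (C n.+2 (m - 2) + C n.+2 (2 * m - 2) + C n.+2 (3 * m - 2))
  + (C n.+2 (m - 8) + C n.+2 (2 * m - 8) + C n.+2 (3 * m - 8)) = 2%:R.
Proof.
case: n => // n odd_n _ m.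
set r := repunit3 n.+1; set k := n.+1 in odd_n r *.
have r1 : (0 < r)%N by rewrite /r repunit3S addn1.
have mE : m = (9 * r + 4)%N by rewrite /m (repunit3S n.+2) (repunit3S n.+1) -/r; lia.
have Cr : C k r = -1 by rewrite C_rep -signr_odd odd_n.
have C2r : C k (2 * r) = 1 by exact: C_2rep.
have C2r1 : C k (2 * r).-1 = -1 by rewrite -subn1; exact: C_2rep1.
have e1 : C k.+2 (m - 2) = C k r - C k r.-1.
  have -> : (m - 2 = 3 * (3 * r.-1.+1) + 2)%N by lia.
  by rewrite C2 C0 prednK.
have e2 : C k.+2 (m - 8) = - C k r.-1.
  have -> : (m - 8 = 3 * (3 * r.-1 + 1) + 2)%N by lia.
  by rewrite C2 C1.
have e3 : C k.+2 (2 * m - 2) = C k (2 * r) + C k (2 * r).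
  have -> : (2 * m - 2 = 3 * (3 * (2 * r) + 1).+1)%N by lia.
  by rewrite C0 -addnS C2 C1 opprK.
have e4 : C k.+2 (2 * m - 8) = C k (2 * r) - C k (2 * r).-1 - C k (2 * r).-1.
  have -> : (2 * m - 8 = 3 * (3 * (2 * r).-1 + 2).+1)%N by lia.
  rewrite C0 C2; congr (_ - _).
  have -> : ((3 * (2 * r).-1 + 2).+1 = 3 * (2 * r).-1.+1)%N by lia.
  by rewrite C0 prednK //; lia.
have e5 : C k.+2 (3 * m - 2) = C k (3 * r).
  have -> : (3 * m - 2 = 3 * (3 * (3 * r).+1) + 1)%N by lia.
  by rewrite C1 C0 C_top ?sub0r ?opprK //; lia.
have e6 : C k.+2 (3 * m - 8) = C k (3 * r).
  have -> : (3 * m - 8 = 3 * (3 * (3 * r) + 1) + 1)%N by lia.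
  by rewrite !C1 opprK.
rewrite e1 e2 e3 e4 e5 e6 Cr C2r C2r1; ring.
Qed.

End AlternatingCubic.

(** * Power sums over the field with 3^n elements *)

(** Translation by [1] permutes the field, so adding [1] to every element does not change the sum of
    all elements. *)
Lemma natr_card_finField (F : finFieldType) : #|F|%:R = 0 :> F.
Proof.
apply: (@addrI _ (\sum_(x : F) x)); rewrite addr0 -sumr_const -big_split /=.
by rewrite [RHS](reindex_inj (addIr (1 : F))).
Qed.

Lemma expf_card_pred (F : finFieldType) (x : F) : x != 0 -> x ^+ #|F|.-1 = 1.
Proof.
move=> x0; apply: (mulfI x0).
by rewrite -exprS mulr1 prednK ?expf_card //; apply/card_gt0P; exists 0.
Qed.

Lemma sum_expr_finField (F : finFieldType) (k : nat) : (0 < k)%N ->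
  \sum_(x : F) x ^+ k = - (#|F|.-1 %| k)%N%:R.
Proof.
move=> k0; set q1 := #|F|.-1.
have F1 : (1 < #|F|)%N by exact: finNzRing_gt1.
have [/dvdnP[c kE]|ndv] := boolP (q1 %| k)%N.
  rewrite (bigD1 0) //= expr0n eqn0Ngt k0 add0r.
  rewrite (eq_bigr (fun _ => 1)); last first.
    by move=> x x0; rewrite kE mulnC exprM expf_card_pred // expr1n.
  rewrite sumr_const (eq_card (B := predC1 (0 : F))) //.
  rewrite cardC1; apply: (@addIr _ 1); rewrite -mulrSr addNr prednK; last exact: ltnW.
  exact: natr_card_finField.
rewrite oppr0; set r := (k %% q1)%N.
have r0 : (0 < r)%N by rewrite lt0n.
(* Otherwise [X^r - 1], of degree [r < q - 1], would have [q - 1] roots. Scaling by [y] permutes the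
   field and multiplies the sum by [y^k], so the sum is zero. *)
have [y y0 yr] : exists2 y : F, y != 0 & y ^+ k != 1.
  apply/exists_inP; apply: contraT; rewrite negb_exists_in => /forall_inP yr.
  have pn0 : 'X^r - 1 != 0 :> {poly F} by rewrite monic_neq0 // monicXnsubC.
  have := @max_poly_roots _ _ (enum (predC1 (0 : F))) pn0.
  rewrite enum_uniq size_XnsubC // -cardE cardC1 ltnS.
  have rq : (r < q1)%N by rewrite ltn_mod /q1; lia.
  rewrite leqNgt rq => /(_ _ isT); apply.
  apply/allP => y; rewrite mem_enum => y0.
  rewrite /root !hornerE subr_eq0.
  have := yr y y0; rewrite negbK {1}(divn_eq k q1) exprD mulnC exprM.
  by rewrite expf_card_pred // expr1n mul1r.
apply/eqP; apply: contraT => s0; case/eqP: yr; apply: (mulIf s0).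
rewrite mul1r mulr_sumr [RHS](reindex_inj (mulfI y0)).
by apply: eq_bigr => x _; rewrite exprMn.
Qed.

(** * Squares and power sums for q = 3^n with n odd *)

Section CubicCharacter.

Variables (F : finFieldType) (n : nat).
Hypothesis odd_n : odd n.
Hypothesis cardF : #|F| = (3 ^ n)%N.

Let m := repunit3 n.

Lemma card_pred_repunit3 : #|F|.-1 = (2 * m)%N.
Proof. by rewrite cardF repunit3E addn1. Qed.

Lemma three_eq0 : 3%:R = 0 :> F.
Proof.
have n0 : (0 < n)%N by case: n odd_n.
by have := natr_card_finField F; rewrite cardF natrX => /eqP; rewrite expf_eq0 n0 => /eqP.
Qed.

Let odd_m : odd m. Proof. by rewrite odd_repunit3. Qed.

Lemma neg1_neq1 : -1 != 1 :> F.
Proof.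
have e : 1 = 3%:R - (1 - (-1)) :> F by ring.
apply/eqP => h; case/eqP: (oner_neq0 F).
by rewrite [LHS]e h three_eq0 subrr subr0.
Qed.

Lemma nonzero_half_power (x : F) : x != 0 ->
  x ^+ m = 1 /\ (exists2 u, u != 0 & x = u ^+ 2) \/
  x ^+ m = -1 /\ (exists2 u, u != 0 & x = - u ^+ 2).
Proof.
(* As [m] is odd, [u^2 = x^(m + 1)], which is [x] or [- x]. *)
move=> x0; set u := x ^+ (m.+1)./2.
have u0 : u != 0 by rewrite expf_neq0.
have u2 : u ^+ 2 = x * x ^+ m.
  by rewrite -exprM muln2 -exprS; congr (_ ^+ _); have := odd_m; lia.
have : (x ^+ m) ^+ 2 == 1 by rewrite -exprM mulnC -card_pred_repunit3 expf_card_pred.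
rewrite sqrf_eq1 => /orP[] /eqP e; [left | right]; split=> //; exists u => //.
  by rewrite u2 e mulr1.
by rewrite u2 e mulrN1 opprK.
Qed.

Lemma sqr_half_power (u : F) : u != 0 -> (u ^+ 2) ^+ m = 1.
Proof. by move=> u0; rewrite -exprM -card_pred_repunit3 expf_card_pred. Qed.

Lemma eq_sqr_or_opp (x : F) : exists u, x = u ^+ 2 \/ x = - u ^+ 2.
Proof.
have [->|x0] := eqVneq x 0; first by exists 0; left; rewrite expr0n.
by have [[_ [u _ xE]]|[_ [u _ xE]]] := nonzero_half_power x0; exists u; [left|right].
Qed.

Lemma sum_two_sqr_eq0 (a b : F) : a ^+ 2 + b ^+ 2 = 0 -> a = 0.
Proof.
move=> h; apply/eqP; apply: contraT => a0.
have b0 : b != 0.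
  by apply: contra a0 => /eqP b0; move: h; rewrite b0 expr0n addr0 => /eqP; rewrite expf_eq0.
have /(congr1 (fun y => y ^+ m)) : a ^+ 2 = - b ^+ 2 by apply/eqP; rewrite -addr_eq0 h.
rewrite exprNn !sqr_half_power // -signr_odd odd_m mulr1 => /eqP.
by rewrite eq_sym (negPf neg1_neq1).
Qed.

Lemma frobenius3_cubic (a b c d : F) : a ^+ 3 = a -> b ^+ 3 = b -> c ^+ 3 = c -> d ^+ 3 = d ->
  forall y, (cubic a b c d).[y ^+ 3] = (cubic a b c d).[y] ^+ 3.
Proof.
move=> a3 b3 c3 d3 y; rewrite !horner_cubic.
have D (s t : F) : (s + t) ^+ 3 = s ^+ 3 + t ^+ 3.
  by apply: (eq_mod3 three_eq0 (c := s ^+ 2 * t + s * t ^+ 2)); ring.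
by rewrite !D !exprMn a3 b3 c3 d3; ring.
Qed.

(** Only exponents divisible by [q - 1 = 2 m] have a nonzero power sum, namely [-1]; as
    [0 < i + k < 4 m], this leaves [i + k] equal to [m], [2 m] or [3 m]. *)
Lemma sum_horner_sqr (P : {poly F}) i : (size P <= (3 * m).+1)%N ->
  (0 < i < m)%N ->
  \sum_z z ^+ (2 * i) * P.[z ^+ 2] = - (P`_(m - i) + P`_(2 * m - i) + P`_(3 * m - i)).
Proof.
move=> sP im.
have -> : \sum_z z ^+ (2 * i) * P.[z ^+ 2]
  = \sum_(k < (3 * m).+1) P`_k * \sum_z z ^+ (2 * (i + k)).
  under eq_bigr => z _ do rewrite (horner_coef_wide _ sP) mulr_sumr.
  rewrite exchange_big /=; apply: eq_bigr => k _.
  rewrite mulr_sumr; apply: eq_bigr => z _; rewrite mulnDr exprD -exprM; ring.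
have ind k : (k < (3 * m).+1)%N -> \sum_(z : F) z ^+ (2 * (i + k))
    = - ((k == m - i)%N%:R + (k == 2 * m - i)%N%:R + (k == 3 * m - i)%N%:R).
  move=> km; rewrite sum_expr_finField; last by lia.
  rewrite card_pred_repunit3 dvdn_pmul2l //; congr (- _).
  have [/dvdnP[c cE]|nd] := boolP (m %| i + k)%N.
    have c3 : (0 < c < 4)%N by nia.
    have [-> -> ->] : [/\ (k == m - i)%N = (c == 1)%N, (k == 2 * m - i)%N = (c == 2)%N
      & (k == 3 * m - i)%N = (c == 3)%N].
      by move: c3 cE; case: c => [|[|[|[|c]]]] //= _ cE; split; lia.
    by move: c3; case: (c) => [|[|[|[|c']]]] //= _; rewrite ?addr0 ?add0r.
  have nk (c : nat) : (i + k)%N = (c * m)%N -> False.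
    by move=> e; rewrite e dvdn_mull in nd.
  have [-> -> ->] : [/\ (k == m - i)%N = false, (k == 2 * m - i)%N = false
      & (k == 3 * m - i)%N = false].
    by split; apply/negbTE/eqP => e; [apply: (nk 1) | apply: (nk 2) | apply: (nk 3)]; lia.
  by rewrite !addr0.
transitivity (\sum_(k < (3 * m).+1) - (
    (if k == (m - i)%N :> nat then P`_k else 0)
    + (if k == (2 * m - i)%N :> nat then P`_k else 0)
    + (if k == (3 * m - i)%N :> nat then P`_k else 0))).
  apply: eq_bigr => k _; rewrite (ind k (ltn_ord k)) mulrN !mulrDr.
  by do 3![case: (_ == _)]; rewrite ?mulr1 ?mulr0.
rewrite sumrN !big_split /= -!big_mkcond /= !big_ord1_eq.
by rewrite !ifT //; lia.
Qed.

Lemma sum_horner (P : {poly F}) j : (size P <= (3 * m).+1)%N ->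
  (0 < j < m)%N -> \sum_z z ^+ j * P.[z] = - P`_(2 * m - j).
Proof.
move=> sP jm.
have -> : \sum_z z ^+ j * P.[z]
  = \sum_(k < (3 * m).+1) P`_k * \sum_z z ^+ (j + k).
  under eq_bigr => z _ do rewrite (horner_coef_wide _ sP) mulr_sumr.
  rewrite exchange_big /=; apply: eq_bigr => k _.
  rewrite mulr_sumr; apply: eq_bigr => z _; rewrite exprD; ring.
transitivity (\sum_(k < (3 * m).+1) - 
    (if k == (2 * m - j)%N :> nat then P`_k else 0)).
  apply: eq_bigr => k _; rewrite sum_expr_finField; last by lia.
  rewrite card_pred_repunit3.
  have -> : (2 * m %| j + k)%N = (k == (2 * m - j)%N :> nat).
    have := ltn_ord k; move=> km; apply/idP/eqP => [/dvdnP[c]|e].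
      by case: c => [|[|c]]; nia.
    by apply/dvdnP; exists 1%N; lia.
  by case: (_ == _); rewrite ?mulrN ?mulr1 ?mulr0.
rewrite sumrN -big_mkcond big_ord1_eq.
by rewrite ifT //; lia.
Qed.

End CubicCharacter.

(** * Existence of z with g(z) and g(-z) nonzero squares *)

Section TwoSquares.

Variables (F : finFieldType) (n : nat).
Hypothesis odd_n : odd n.
Hypothesis cardF : #|F| = (3 ^ n)%N.
Hypothesis n5 : (5 <= n)%N.

Let m := repunit3 n.
Let g (z : F) := z ^+ 3 + z ^+ 2 + 1.

Let m_ge : (121 <= m)%N.
Proof.
have := repunit3E n; have : (3 ^ 5 <= 3 ^ n)%N by rewrite leq_exp2l.
rewrite -/m (_ : 3 ^ 5 = 243)%N //; lia.
Qed.

Let frob (a b c d : F) (z : F) : a ^+ 3 = a -> b ^+ 3 = b -> c ^+ 3 = c -> d ^+ 3 = d ->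
  (a + b * z + c * z ^+ 2 + d * z ^+ 3) ^+ m = (frobenius_prod (cubic a b c d) n).[z].
Proof.
move=> a3 b3 c3 d3; rewrite horner_frobenius_prod ?horner_cubic //.
exact: (frobenius3_cubic odd_n cardF).
Qed.

Let sum_pow j : (0 < j <= 16)%N -> \sum_(z : F) z ^+ j = 0.
Proof.
move=> j16; rewrite sum_expr_finField; last by lia.
rewrite (card_pred_repunit3 cardF) gtnNdvd ?oppr0 //; have := m_ge; rewrite /m; lia.
Qed.

(** As [m] is [1] modulo 3, the index [2 m - j] ends in the base 3 digit [1], so its coefficient has
    as a factor the linear coefficient of [g], which is [0]. Both [4] and [16] are admissible
    [j]. *)
Lemma sum_pow_cubic j : (0 < j <= 16)%N -> j = 1 %[mod 3] ->
  \sum_(z : F) z ^+ j * g z ^+ m = 0.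
Proof.
move=> j16 j3.
transitivity (\sum_(z : F) z ^+ j * (frobenius_prod (cubic 1 0 1 1) n).[z]).
  apply: eq_bigr => z _; rewrite -frob ?expr1n ?expr0n //; congr (_ * _ ^+ _).
  rewrite /g; ring.
rewrite (sum_horner odd_n cardF);
  [|exact/size_frobenius_prod/size_cubic | have := m_ge; rewrite /m; lia].
rewrite -/m; case: n n5 @m m_ge => // n' _ m' mge.
have -> : (2 * m' - j = 3 * ((2 * m' - j) %/ 3) + 1)%N.
  have := repunit3S n'; rewrite -/m'; lia.
by rewrite coef_frobenius_prod_mod1 mul0r oppr0.
Qed.

Lemma sum_pow_cubicN j : (0 < j <= 16)%N -> ~~ odd j -> j = 1 %[mod 3] ->
  \sum_(z : F) z ^+ j * g (- z) ^+ m = 0.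
Proof.
move=> j16 oj j3; rewrite (reindex_inj oppr_inj) -[RHS](sum_pow_cubic j16 j3).
by apply: eq_bigr => z _; rewrite opprK exprNn -signr_odd (negPf oj) mul1r.
Qed.

Lemma mul_cubicN (z : F) : g z * g (- z) =
  1 + -1 * z ^+ 2 + 1 * (z ^+ 2) ^+ 2 + -1 * (z ^+ 2) ^+ 3.
Proof.
by apply: (eq_mod3 (three_eq0 odd_n cardF) (c := z ^+ 2)); rewrite /g; ring.
Qed.

Lemma sum_pow_difference :
  \sum_(z : F) (z ^+ 4 - z ^+ 16) * (g z * g (- z)) ^+ m = 2%:R.
Proof.
transitivity (\sum_(z : F) z ^+ (2 * 2) * (frobenius_prod (cubic 1 (-1) 1 (-1)) n).[z ^+ 2]
  - \sum_(z : F) z ^+ (2 * 8) * (frobenius_prod (cubic 1 (-1) 1 (-1)) n).[z ^+ 2]).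
  rewrite -sumrB; apply: eq_bigr => z _.
  have N3 : (-1) ^+ 3 = -1 :> F by ring.
  by rewrite mul_cubicN frob ?expr1n // mulrBl.
have s4 := size_frobenius_prod n (size_cubic (1 : F) (-1) 1 (-1)).
have mg := m_ge; rewrite /m in mg.
rewrite !(sum_horner_sqr odd_n cardF) //; [|lia|lia].
move: odd_n n5 => /= on n_ge5.
have nE : n = n.-2.+2 by lia.
rewrite opprK nE; apply: coef_difference; lia.
Qed.

Lemma exists_two_squares : exists z a c : F,
  [/\ z != 0, a != 0, c != 0, z ^+ 3 + z ^+ 2 + 1 = a ^+ 2
    & - z ^+ 3 + z ^+ 2 + 1 = c ^+ 2].
Proof.
have gN (z : F) : - z ^+ 3 + z ^+ 2 + 1 = g (- z) by rewrite /g; ring.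
have m0 : (0 < m)%N by have := m_ge; lia.
have pos y : y ^+ m = 1 -> exists2 u : F, u != 0 & y = u ^+ 2.
  move=> y1; have y0 : y != 0.
    apply/eqP => y0; move/eqP: y1.
    by rewrite y0 expr0n eqn0Ngt m0 eq_sym oner_eq0.
  have [[]//|[yN _]] := nonzero_half_power odd_n cardF y0.
  by move: (neg1_neq1 odd_n cardF); rewrite -yN y1 eqxx.
case: (boolP [exists z, [&& z != 0, g z ^+ m == 1 & g (- z) ^+ m == 1]]).
  case/existsP => z /and3P[z0 /eqP/pos[a a0 aE] /eqP/pos[c c0 cE]].
  by exists z, a, c; rewrite gN.
rewrite negb_exists => /forallP nz; exfalso.
have fact (z : F) : g z = (z - 1) * (z ^+ 2 - z - 1).
  by apply: (eq_mod3 (three_eq0 odd_n cardF) (c := z ^+ 2)); rewrite /g; ring.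
have groot z : g z = 0 -> z = 1.
  rewrite fact => /eqP; rewrite mulf_eq0.
  rewrite (negPf (factor_neq0 (three_eq0 odd_n cardF) (sum_two_sqr_eq0 odd_n cardF) _)) orbF.
  by rewrite subr_eq0 => /eqP.
have half (y : F) : y != 0 -> (y ^+ m == 1) || (y ^+ m == -1).
  by move=> y0; have [[-> _]|[-> _]] := nonzero_half_power odd_n cardF y0;
    rewrite eqxx ?orbT.
(* The factor [z^4 - z^16] vanishes at [0] and at the roots [1] of [g(z)] and [-1] of [g(-z)];
   elsewhere both half powers are [1] or [-1], and not both [1]. *)
have zero z : (z ^+ 4 - z ^+ 16) * ((1 + g z ^+ m) * (1 + g (- z) ^+ m)) = 0.
  have [->|z0] := eqVneq z 0; first by rewrite !expr0n subrr mul0r.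
  have [/groot ->|g0] := eqVneq (g z) 0; first by rewrite !expr1n subrr mul0r.
  have [/groot zE|g0'] := eqVneq (g (- z)) 0.
    by rewrite -[z]opprK zE (_ : _ - _ = 0) ?mul0r //; ring.
  move: (nz z); rewrite z0 /=.
  case/orP: (half _ g0) => /eqP ->; last by rewrite addrN mul0r mulr0.
  case/orP: (half _ g0') => /eqP ->; last by rewrite addrN !mulr0.
  by rewrite eqxx.
have two0 : 2%:R = 0 :> F.
  rewrite -sum_pow_difference.
  transitivity (\sum_(z : F) (z ^+ 4 - z ^+ 16) * ((1 + g z ^+ m) * (1 + g (- z) ^+ m)));
    last by rewrite big1.
  transitivity (\sum_(z : F) (z ^+ 4 - z ^+ 16) * (g z * g (- z)) ^+ m
    + (\sum_(z : F) z ^+ 4 - \sum_(z : F) z ^+ 16)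
    + (\sum_(z : F) z ^+ 4 * g z ^+ m - \sum_(z : F) z ^+ 16 * g z ^+ m)
    + (\sum_(z : F) z ^+ 4 * g (- z) ^+ m - \sum_(z : F) z ^+ 16 * g (- z) ^+ m)).
    by rewrite !sum_pow ?sum_pow_cubic ?sum_pow_cubicN // !subr0 !addr0.
  rewrite -!sumrB -!big_split /=; apply: eq_bigr => z _; rewrite exprMn; ring.
have e : -1 - 1 = - 2%:R :> F by ring.
by have := neg1_neq1 odd_n cardF; rewrite -subr_eq0 e two0 oppr0 eqxx.
Qed.

End TwoSquares.

(** * The exponent and the conclusion *)

(** Since [(u^2)^m = 1] for nonzero [u], the equation gives [f (u^8) = (u^2)^(4 d) = u^2]; evenness
    gives the same value at [- u^8]. *)
Lemma APN_exponentE n : odd n ->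
  exists2 k, (4 * APN_exponent n = (2 * k + 1) * repunit3 n + 1)%N
    & ~~ odd (APN_exponent n).
Proof.
move=> odd_n; set r := repunit3 n.
have q1 : (3 ^ n - 1 = 2 * r)%N by rewrite repunit3E addnK.
have q3 : (3 ^ n.+1 - 1 = 6 * r + 2)%N by rewrite expnS repunit3E -/r; lia.
rewrite /APN_exponent q1 q3.
(* [repunit3 (n + 4) = 81 * repunit3 n + 40], so the residue modulo 8 depends only on [n] modulo
   4. *)
have r8 : (r %% 8 = if n %% 4 == 3 then 5 else 1)%N.
  have nE : n = (4 * (n %/ 4) + (if n %% 4 == 3 then 3 else 1))%N by case: ifP; lia.
  rewrite /r [in LHS]nE; case: ifP => _; elim: (n %/ 4)%N => [//|k IH].
    have -> : (4 * k.+1 + 3 = (4 * k + 3).+4)%N by lia.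
    rewrite !repunit3S; lia.
  have -> : (4 * k.+1 + 1 = (4 * k + 1).+4)%N by lia.
  rewrite !repunit3S; lia.
(* The value of [4 d] is [3 r + 1] in the first case and [3 r + 1 + 4 r] in the second. *)
move: r8; case: ifP => _ r8; [exists 1%N | exists 3%N]; lia.
Qed.

Lemma num_sols_scale (F : finFieldType) (d : nat) (a b : F) : a != 0 ->
  num_sols (fun x => x ^+ d) a b = num_sols (fun x => x ^+ d) 1 (b / a ^+ d).
Proof.
move=> a0; rewrite /num_sols -[RHS](card_imset _ (mulfI a0)).
have ad : a ^+ d != 0 by rewrite expf_neq0.
have scale y : (a * y + a) ^+ d - (a * y) ^+ d = a ^+ d * ((y + 1) ^+ d - y ^+ d).
  by rewrite mulrBr -!exprMn mulrDr mulr1.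
have solE y : ((a * y + a) ^+ d - (a * y) ^+ d == b)
    = ((y + 1) ^+ d - y ^+ d == b / a ^+ d).
  by rewrite scale -[RHS](inj_eq (mulfI ad)) [in RHS]mulrCA divff // mulr1.
apply: eq_card => x; apply/idP/imsetP => [xb|[y yb ->]]; last first.
  by move: yb; rewrite !inE solE.
have xE : x = a * (x / a) by rewrite mulrC divfK.
by exists (x / a) => //; move: xb; rewrite !inE {1 2}xE solE.
Qed.

Theorem mainTheorem2 (n : nat) (hn5 : (5 <= n)%N) (hodd : odd n)
    (F : finFieldType) (hF : #|F| = (3 ^ n)%N) :
  APN (fun x : F => (x ^+ APN_exponent n)%R).
Proof.
have [k dE d_even] := APN_exponentE hodd.
set d := APN_exponent n in dE d_even *; set f := fun x : F => x ^+ d.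
have f8 (u : F) : f (u ^+ 8) = u ^+ 2.
  rewrite /f; have [->|u0] := eqVneq u 0.
    rewrite -exprM !expr0n muln_eq0 /= (_ : (d == 0)%N = false) //; lia.
  have -> : (u ^+ 8) ^+ d = (u ^+ 2) ^+ (4 * d) by rewrite -!exprM mulnA.
  rewrite dE addn1 exprS (mulnC _ (repunit3 n)) exprM.
  by rewrite (sqr_half_power hF) // expr1n mulr1.
have f8N (u : F) : f (- u ^+ 8) = u ^+ 2.
  by rewrite -f8 /f exprNn -signr_odd (negPf d_even) mul1r.
have h3 := three_eq0 hodd hF; have hs := sum_two_sqr_eq0 hodd hF.
have hq := eq_sqr_or_opp hodd hF.
apply/eqP; rewrite eqn_leq; apply/andP; split.
  apply/bigmax_leqP => -[a b] /= a0; rewrite /f num_sols_scale // -/f.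
  rewrite leqNgt; apply/negP => /card_gt2P[x [y [z [[xS yS zS] [xy yz zx]]]]].
  move: xS yS zS; rewrite !inE => /eqP xS /eqP yS /eqP zS.
  have same x' y' : same_sign f x' -> same_sign f y' -> x' != y' ->
      f (x' + 1) - f x' = f (y' + 1) - f y' -> False.
    by move=> hx hy /eqP + e; apply; apply: (same_sign_inj h3 hs hx hy e).
  have opp x' y' : opposite_sign f x' -> opposite_sign f y' -> x' != y' ->
      f (x' + 1) - f x' = f (y' + 1) - f y' -> False.
    by move=> hx hy /eqP + e; apply; apply: (opposite_sign_inj h3 hs hx hy e).
  have exy : f (x + 1) - f x = f (y + 1) - f y by rewrite xS yS.
  have eyz : f (y + 1) - f y = f (z + 1) - f z by rewrite zS yS.
  have ezx : f (z + 1) - f z = f (x + 1) - f x by rewrite zS xS.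
  have sg := same_or_opposite hq f8 f8N.
  (* Among three distinct solutions two are of the same kind. *)
  have [[hx|hx] [[hy|hy] [hz|hz]]] := (sg x, (sg y, sg z)); eauto.
have [z [a [c [z0 a0 c0 ga gc]]]] := exists_two_squares hodd hF hn5.
have [x [x' [xx' fxx']]] : exists x x', x != x' /\ f (x + 1) - f x = f (x' + 1) - f x'.
  have [//|[b bP]] := not_planar h3 hs hq f8 f8N z0 ga gc a0 c0.
  pose D x := f (x + 1) - f x.
  (* A self-map of a finite set that misses a value also repeats one. *)
  have /injectivePn[x [y xy Dxy]] : ~~ injectiveb D.
    apply/injectiveP => injD; have [D' _ D'K] := injF_bij injD.
    by have := bP (D' b); rewrite -/(D _) D'K eqxx.
  by exists x, y.
apply: leq_trans (leq_bigmax_cond (1, f (x + 1) - f x) _); last exact: oner_neq0.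
rewrite /num_sols /= -(_ : #|[set x; x']| = 2%N); last by rewrite cards2 xx'.
by apply/subset_leq_card/subsetP => y; rewrite !inE => /orP[] /eqP ->; rewrite ?fxx'.
Qed.
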